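(* Let $m\ge2$, let $f\in\mathcal{O}_0^K$ have the form $f(x)=x+x^m+\mu x^{2m-1}+\sum_{j=2m}^\infty a_jx^j$, and let $n\ge1$ be a natural number. Then there is a unique $g\in\mathcal{O}_0^K$ tangent to the identity satisfying $g^{\circ n}=f$.
   Context: $K$ is a field of characteristic $0$, complete with respect to a nontrivial non-archimedean absolute value. $\mathcal{O}_0^K$ is the ring of power series in $K[[x]]$ with positive radius of convergence about $0$. A power series is tangent to the identity if it has the form $x+O(x^2)$. $g^{\circ n}$ denotes the $n$-th compositional iterate of $g$. *)

(* Defs.v *)
From mathcomp Require Import all_boot all_order all_algebra.
From mathcomp Require Import all_classical all_reals all_analysis.

Set Implicit Arguments.
Unset Strict Implicit.
Unset Printing Implicit Defensive.

Import Order.TTheory GRing.Theory Num.Theory numFieldNormedType.Exports.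

Local Open Scope classical_set_scope.
Local Open Scope ring_scope.

Section AbsoluteValue.
Context {R : realType} {K : fieldType}.
Implicit Type abs : K -> R.

Record nonarch_absolute_value abs : Prop := NonarchAbsoluteValue {
  nonarch_abs_ge0 : forall x, 0 <= abs x;
  nonarch_abs_eq0 : forall x, abs x = 0 <-> x = 0;
  nonarch_absM : forall x y, abs (x * y) = abs x * abs y;
  nonarch_absD : forall x y, abs (x + y) <= Num.max (abs x) (abs y)
}.

Definition nontrivial_abs abs := exists x : K, x != 0 /\ abs x != 1.

Definition abs_cauchy abs (u : nat -> K) :=
  forall e : R, 0 < e ->
    exists N : nat, forall i j : nat,
      (N <= i)%N -> (N <= j)%N -> abs (u i - u j) < e.

Definition abs_converges abs (u : nat -> K) (l : K) :=
  (fun n => abs (u n - l)) @ \oo --> (0 : R).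

Definition abs_complete abs :=
  forall u : nat -> K, abs_cauchy abs u -> exists l : K, abs_converges abs u l.

End AbsoluteValue.

(* K[[x]]; a series is identified with its sequence of coefficients. *)
Definition fps (K : fieldType) := nat -> K.

Section PowerSeries.
Context {K : fieldType}.
Implicit Types f g : fps K.

Definition fps1 : fps K := fun k => (k == 0%N)%:R.

Definition fpsX : fps K := fun k => (k == 1%N)%:R.

Definition fps_mul f g : fps K := fun k => \sum_(i < k.+1) f i * g (k - i)%N.

Definition fps_exp g n : fps K := iter n (fps_mul g) fps1.

(* f o g = \sum_i f_i g^i, to be used only when g 0 = 0: then g^i starts in
   degree at least i, so only the terms with i <= k contribute to degree k. *)
Definition fps_comp f g : fps K :=
  fun k => \sum_(i < k.+1) f i * fps_exp g i k.

Definition fps_iter g n : fps K := iter n (fps_comp g) fpsX.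

Definition tangent_to_id g := g 0%N = 0 /\ g 1%N = 1.

End PowerSeries.

Section Convergence.
Context {R : realType} {K : fieldType}.
Variable abs : K -> R.

(* Over a complete non-archimedean field a series converges iff its terms tend
   to 0, so convergence at radius r means |a_k| r^k --> 0.  Letting r range over
   all nonnegative reals, rather than over the values of abs, gives the usual
   1 / limsup |a_k|^(1/k) also when the value group is discrete. *)
Definition convergence_radius (a : fps K) : \bar R :=
  ereal_sup [set r%:E | r in
    [set r : R | 0 <= r /\ (fun k => abs (a k) * r ^+ k) @ \oo --> (0 : R)]].

Definition convergent_fps (a : fps K) := (0 < convergence_radius a)%E.

End Convergence.

(* Main.v *)
Require Import Defs.
From mathcomp Require Import all_boot all_order all_algebra.
From mathcomp Require Import all_classical all_reals all_analysis.
From mathcomp Require Import zify ring.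

(* Let D h = h o f - h.  Since D raises the order of a series, the Newton
   expansion f^s = \sum_j binom(s, j) D^j X makes sense for every s in K; its
   coefficients are polynomial in s and it gives the iterates of f at the
   naturals.  In characteristic 0 an identity between polynomials in s can be
   checked at the naturals, so the n-th iterate of f^s is f^(n s), and any g with
   n-th iterate f satisfies f^s = g^(n s): the root exists, is unique, and is
   f^(1/n).
   If |f - X|_r <= c r for the Gauss norm of radius r, then |D h|_r <= c |h|_r by
   the ultrametric inequality, and c tends to 0 with r because f is tangent to
   the identity.  As |j!| decays at most geometrically, |binom(1/n, j)| <= B^j,
   so for r small the Newton expansion of f^(1/n) is bounded by r in Gauss norm. *)

Set Implicit Arguments.
Unset Strict Implicit.
Unset Printing Implicit Defensive.

Import Order.TTheory GRing.Theory Num.Theory numFieldNormedType.Exports.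
Local Open Scope ring_scope.

(** * Composition of power series, through polynomial truncations *)

Lemma big_ord_widen0 (V : nmodType) (m n : nat) (F : nat -> V) : (m <= n)%N ->
  (forall i, (m <= i)%N -> F i = 0) -> \sum_(i < n) F i = \sum_(i < m) F i.
Proof.
move=> le_mn F0; rewrite -!(big_mkord xpredT F) (big_cat_nat (leq0n m) le_mn) /=.
by rewrite addrC big_nat_cond big1 ?add0r // => i /andP[/andP[/F0]].
Qed.

Section Composition.
Context {K : fieldType}.
Implicit Types (a b c f g h : fps K) (p q : {poly K}).

Lemma fps_exp_low a e k : a 0%N = 0 -> (k < e)%N -> fps_exp a e k = 0.
Proof.
move=> a0; elim: e k => // e IHe k le_ke; rewrite /= /fps_mul big1 // => -[[|i] ?] _ /=.
  by rewrite a0 mul0r.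
by rewrite [fps_exp _ _ _]IHe ?mulr0 //; lia.
Qed.

Lemma fps_exp_poly q b k e : (forall i, (i <= k)%N -> q`_i = b i) ->
  (q ^+ e)`_k = fps_exp b e k.
Proof.
elim: e k => [|e IHe] k qb; first by rewrite expr0 coef1.
rewrite exprS coefM /= /fps_mul.
apply: eq_bigr => i _.
have le_ik : (i <= k)%N by rewrite -ltnS.
rewrite (qb i) //; congr (_ * _).
apply: IHe => j le_j.
by apply: qb; apply: leq_trans le_j (leq_subr _ _).
Qed.

(** Coefficient [k] only sees degrees up to [k], because [b 0 = 0]; this carries the laws of
    polynomial composition over to series. *)
Lemma fps_comp_poly p q a b k : b 0%N = 0 ->
  (forall i, (i <= k)%N -> p`_i = a i) -> (forall i, (i <= k)%N -> q`_i = b i) ->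
  (p \Po q)`_k = fps_comp a b k.
Proof.
move=> b0 pa qb; pose F i := p`_i * (q ^+ i)`_k.
(* The sum over [size p] is widened to the maximum of both ranges, where the new coefficients of [p]
   are 0, and then cut to [k.+1], since [q ^+ i] has no term of degree [k] for [i > k]. *)
rewrite coef_comp_poly /fps_comp -(@big_ord_widen0 _ _ (maxn (size p) k.+1) F) ?leq_maxl //; last first.
  by move=> i le_i; rewrite /F nth_default ?mul0r.
rewrite (@big_ord_widen0 _ k.+1) ?leq_maxr // => [|i lt_ki].
  apply: eq_bigr => -[i /= lt_ik] _; rewrite /F (pa i) //.
  by rewrite (@fps_exp_poly _ b).
by rewrite /F (@fps_exp_poly _ b) // fps_exp_low ?mulr0.
Qed.

Definition fps_trunc N a : {poly K} := \poly_(i < N) a i.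

Lemma coef_fps_trunc N a i : (i < N)%N -> (fps_trunc N a)`_i = a i.
Proof. by move=> lt_iN; rewrite coef_poly lt_iN. Qed.

Lemma fps_comp0 a b : fps_comp a b 0%N = a 0%N.
Proof. by rewrite /fps_comp big_ord1 /= /fps1 mulr1. Qed.

Lemma fps_compA a b c : b 0%N = 0 -> c 0%N = 0 ->
  fps_comp (fps_comp a b) c = fps_comp a (fps_comp b c).
Proof.
move=> b0 c0; apply/funext => k.
have tr d i : (i <= k)%N -> (fps_trunc k.+1 d)`_i = d i by move=> le_ik; rewrite coef_fps_trunc.
rewrite -(@fps_comp_poly (fps_trunc k.+1 a \Po fps_trunc k.+1 b) (fps_trunc k.+1 c)) //; last exact: tr.
  rewrite -comp_polyA (@fps_comp_poly _ _ a (fps_comp b c)) ?fps_comp0 //; first exact: tr.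
  by move=> i le_ik; apply: fps_comp_poly => // j le_ji; apply: tr; apply: leq_trans le_ik.
by move=> i le_ik; apply: fps_comp_poly => // j le_ji; apply: tr; apply: leq_trans le_ik.
Qed.

Lemma fps_compX a : a 0%N = 0 -> fps_comp (@fpsX K) a = a.
Proof.
move=> a0; apply/funext => k.
rewrite -(@fps_comp_poly 'X (fps_trunc k.+1 a)) // => [|i _|i le_ik].
- by rewrite comp_polyX coef_fps_trunc.
- by rewrite coefX.
- by rewrite coef_fps_trunc.
Qed.

Lemma fps_expX e k : fps_exp (@fpsX K) e k = (k == e)%:R.
Proof. by rewrite -(@fps_exp_poly 'X) ?coefXn // => i _; rewrite coefX. Qed.

Lemma fps_comp_X a : fps_comp a (@fpsX K) = a.
Proof.
apply/funext => k; rewrite /fps_comp (bigD1 (@ord_max k)) //= big1 => [|i ne_ik].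
  by rewrite addr0 fps_expX eqxx mulr1.
by rewrite fps_expX (_ : k == i = false) ?mulr0 // eq_sym; apply: negPf; exact: ne_ik.
Qed.

Lemma fps_iter0 f n : f 0%N = 0 -> fps_iter f n 0%N = 0.
Proof. by move=> f0; elim: n => // n; rewrite /fps_iter /= fps_comp0. Qed.

Lemma fps_iter_comp f n h : f 0%N = 0 -> h 0%N = 0 ->
  iter n (fps_comp f) h = fps_comp (fps_iter f n) h.
Proof.
move=> f0 h0; elim: n => [|n IHn] /=; first by rewrite fps_compX.
by rewrite IHn -fps_compA ?fps_iter0.
Qed.

Lemma fps_iterM f s n : f 0%N = 0 -> fps_iter (fps_iter f s) n = fps_iter f (n * s).
Proof.
move=> f0; elim: n => //= n IHn; rewrite mulSn [RHS]iterD -[iter (n * s) _ _]/(fps_iter f (n * s)).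
by rewrite -IHn fps_iter_comp ?fps_iter0.
Qed.

(** The Newton expansion concerns composition with [f] on the right, which is linear in the other
    series; associativity switches sides. *)
Lemma fps_iterE f n : f 0%N = 0 ->
  fps_iter f n = iter n (fun h => fps_comp h f) (@fpsX K).
Proof.
move=> f0; elim: n => // n IHn; rewrite iterS -IHn.
rewrite {1}/fps_iter iterSr fps_comp_X.
by rewrite -[in LHS](fps_compX f0) fps_iter_comp ?fps_compX.
Qed.

End Composition.

(** * The difference operator D and Newton's formula *)

Section Newton.
Context {K : fieldType}.
Implicit Types f g h : fps K.

Definition fps_delta f h : fps K := fun k => fps_comp h f k - h k.

Lemma fps_deltaD f h1 h2 :
  fps_delta f (fun k => h1 k + h2 k) = fun k => fps_delta f h1 k + fps_delta f h2 k.
Proof.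
apply/funext => k; rewrite /fps_delta opprD addrACA; congr (_ + _).
by rewrite /fps_comp -big_split; apply: eq_bigr => i _; rewrite mulrDl.
Qed.

Lemma iter_fps_deltaD f h1 h2 j : iter j (fps_delta f) (fun k => h1 k + h2 k) =
  fun k => iter j (fps_delta f) h1 k + iter j (fps_delta f) h2 k.
Proof. by elim: j => //= j ->; rewrite fps_deltaD. Qed.

(** Right composition with [f] is 1 + D, so this is the binomial theorem for (1 + D)^s. Terms with j
    > s vanish, which leaves [N] free for the induction and for later comparison of ranges. *)
Lemma iter_fps_comp_delta f h N s k : (s < N)%N ->
  iter s (fun h' => fps_comp h' f) h k =
  \sum_(j < N) 'C(s, j)%:R * iter j (fps_delta f) h k.
Proof.
elim: s N h => [|s IHs] [|N] h // lt_sN.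
  by rewrite big_ord_recl big1 ?addr0 ?mul1r // => i _; rewrite mul0r.
have comp_delta : fps_comp h f = fun k => h k + fps_delta f h k.
  by apply/funext => i; rewrite /fps_delta addrC subrK.
rewrite iterSr (IHs N.+1) ?(ltnW lt_sN) // comp_delta.
under eq_bigr do rewrite iter_fps_deltaD mulrDr -iterSr.
(* The last term of the second sum has binomial coefficient 0. With the first term of the first sum
   set apart, Pascal's rule merges the rest. *)
rewrite big_split /= [X in _ + X]big_ord_recr /= (@bin_small s N lt_sN) mul0r addr0.
rewrite [X in X + _]big_ord_recl [in RHS]big_ord_recl !bin0 -addrA; congr (_ + _).
rewrite -big_split /=; apply: eq_bigr => i _; rewrite -mulrDl -natrD.
by rewrite -[bump 0 i]/(i.+1) binS.
Qed.

(** Writing [h] as h o X reduces D to the differences f^i - X^i, whose order and Gauss norm can be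
    estimated. *)
Lemma fps_deltaE f h k :
  fps_delta f h k = \sum_(i < k.+1) h i * (fps_exp f i k - (k == i)%:R).
Proof.
rewrite /fps_delta -{2}[h]fps_comp_X /fps_comp -sumrB.
by apply: eq_bigr => i _; rewrite mulrBr fps_expX.
Qed.

Lemma fps_exp_lead f i : tangent_to_id f -> fps_exp f i i = 1.
Proof.
move=> [f0 f1]; elim: i => //= i IHi; rewrite /fps_mul !big_ord_recl f0 mul0r add0r.
rewrite /= f1 mul1r subn1 /= IHi big1 ?addr0 // => j _.
by rewrite [fps_exp _ _ _]fps_exp_low ?mulr0 //= /bump !leq0n; have := ltn_ord j; lia.
Qed.

(** The leading terms of f^i and X^i cancel, so each application of D raises the order by at least
    one, starting from order 1 for X. *)
Lemma iter_fps_delta_low f j k : tangent_to_id f -> (k <= j)%N ->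
  iter j (fps_delta f) (@fpsX K) k = 0.
Proof.
move=> f_tan; elim: j k => [|j IHj] k le_kj; first by case: k le_kj.
rewrite iterS fps_deltaE big1 // => -[i /= lt_ik] _.
have [le_ij|lt_ji] := leqP i j; first by rewrite IHj ?mul0r.
have -> : k = i by lia.
by rewrite fps_exp_lead // eqxx subrr mulr0.
Qed.

End Newton.

(** * Polynomial dependence on the exponent, and fractional iterates *)

Section PolynomialFamilies.
Context {K : fieldType}.
Context (K_char0 : [pchar K] =i pred0).

Definition polynomial_fun (u : K -> K) := exists p : {poly K}, forall s, u s = p.[s].

Definition polynomial_family (F : K -> fps K) :=
  forall k, polynomial_fun (fun s => F s k).

(** In characteristic 0 the naturals are pairwise distinct in [K], so a nonzero difference would
    have more roots than its degree allows. *)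
Lemma polynomial_fun_eq (u v : K -> K) : polynomial_fun u -> polynomial_fun v ->
  (forall n : nat, u n%:R = v n%:R) -> u =1 v.
Proof.
move=> [p up] [q vq] uv s; rewrite up vq; apply/eqP; rewrite -subr_eq0 -hornerN -hornerD.
have [->|pq_neq0] := eqVneq (p - q) 0; first by rewrite horner0.
have := @max_poly_roots _ (p - q) [seq i%:R | i <- iota 0 (size (p - q)%R)] pq_neq0.
rewrite size_map size_iota ltnn; move=> /(_ _ _)/wrap[] //.
- by apply/allP => _ /mapP[i _ ->]; rewrite rootE hornerD hornerN -up -vq uv subrr.
- rewrite map_inj_uniq ?iota_uniq // => i j /eqP.
  wlog le_ij : i j / (i <= j)%N => [hw|].
    by case/orP: (leq_total i j) => /hw // hij; rewrite eq_sym => /hij.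
  rewrite eq_sym -subr_eq0 -natrB // (pcharf0P K).1 // subn_eq0 => le_ji.
  by apply/eqP; rewrite eqn_leq le_ij.
Qed.

Lemma polynomial_fun_cst c : polynomial_fun (fun=> c).
Proof. by exists c%:P => s; rewrite hornerC. Qed.

Lemma polynomial_fun_scale c : polynomial_fun ( *%R c).
Proof. by exists (c%:P * 'X) => s; rewrite hornerM hornerC hornerX. Qed.

Lemma polynomial_funM u v : polynomial_fun u -> polynomial_fun v ->
  polynomial_fun (fun s => u s * v s).
Proof. by move=> [p up] [q vq]; exists (p * q) => s; rewrite up vq hornerM. Qed.

Lemma polynomial_fun_comp u v : polynomial_fun u -> polynomial_fun v ->
  polynomial_fun (u \o v).
Proof. by move=> [p up] [q vq]; exists (p \Po q) => s; rewrite /= up vq horner_comp. Qed.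

Lemma polynomial_fun_sum (I : Type) (r : seq I) (u : I -> K -> K) :
  (forall i, polynomial_fun (u i)) -> polynomial_fun (fun s => \sum_(i <- r) u i s).
Proof.
move=> /choice[p up]; exists (\sum_(i <- r) p i) => s.
by rewrite horner_sum; apply: eq_bigr => i _.
Qed.

Lemma polynomial_fun_prod (I : Type) (r : seq I) (u : I -> K -> K) :
  (forall i, polynomial_fun (u i)) -> polynomial_fun (fun s => \prod_(i <- r) u i s).
Proof.
move=> /choice[p up]; exists (\prod_(i <- r) p i) => s.
by rewrite horner_prod; apply: eq_bigr => i _.
Qed.

Lemma polynomial_family_exp F e : polynomial_family F ->
  polynomial_family (fun s => fps_exp (F s) e).
Proof.
move=> F_poly; elim: e => [|e IHe] k; first exact: polynomial_fun_cst.
by apply: polynomial_fun_sum => i; apply: polynomial_funM; [exact: F_poly|exact: IHe].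
Qed.

Lemma polynomial_family_comp F G : polynomial_family F -> polynomial_family G ->
  polynomial_family (fun s => fps_comp (F s) (G s)).
Proof.
move=> F_poly G_poly k; apply: polynomial_fun_sum => i.
by apply: polynomial_funM; [exact: F_poly|exact: polynomial_family_exp].
Qed.

Lemma polynomial_family_iter F n : polynomial_family F ->
  polynomial_family (fun s => fps_iter (F s) n).
Proof.
move=> F_poly; elim: n => [|n IHn]; first by move=> k; exact: polynomial_fun_cst.
exact: polynomial_family_comp.
Qed.

(** The binomial coefficient binom(s, j) for an arbitrary [s] in [K]. *)
Definition binomial_fun (s : K) j := (\prod_(i < j) (s - i%:R)) / j`!%:R.

Lemma binomial_fun_nat n j : binomial_fun n%:R j = 'C(n, j)%:R.
Proof.
apply: (canLR (mulfK _)); first by rewrite (pcharf0P K).1 // -lt0n fact_gt0.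
rewrite -natrM bin_ffact; elim: j => [|j IHj]; first by rewrite big_ord0.
rewrite big_ord_recr /= IHj ffactnSr natrM.
by have [le_jn|lt_nj] := leqP j n; [rewrite natrB|rewrite ffact_small // !mul0r].
Qed.

Lemma polynomial_fun_binomial j : polynomial_fun (binomial_fun^~ j).
Proof.
apply: polynomial_funM; last exact: polynomial_fun_cst.
apply: polynomial_fun_prod => i.
by exists ('X - i%:R%:P) => s; rewrite hornerXsubC.
Qed.

(* The Newton expansion of (1 + D)^s X, with D = fps_delta f; D^j X starts in
   degree at least j + 1, so the terms with j > k vanish in degree k. *)
Definition fps_power f (s : K) : fps K := fun k =>
  \sum_(j < k.+1) binomial_fun s j * iter j (fps_delta f) (@fpsX K) k.

Lemma polynomial_family_power f : polynomial_family (fps_power f).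
Proof.
move=> k; apply: polynomial_fun_sum => j.
by apply: polynomial_funM; [exact: polynomial_fun_binomial|exact: polynomial_fun_cst].
Qed.

Lemma fps_power_tangent f s : tangent_to_id f -> tangent_to_id (fps_power f s).
Proof.
move=> f_tan; split; rewrite /fps_power !big_ord_recl big_ord0 /=.
  by rewrite mulr0 addr0.
rewrite -[fps_delta f _ _]/(iter 1 (fps_delta f) fpsX 1%N) iter_fps_delta_low //.
by rewrite mulr0 !addr0 /binomial_fun big_ord0 divr1 mulr1.
Qed.

Lemma fps_power_nat f n : tangent_to_id f -> fps_power f n%:R = fps_iter f n.
Proof.
move=> f_tan; have [f0 _] := f_tan; apply/funext => k.
(* The range [(n + k).+1] covers both truncations: binom(n, j) is 0 for j > n, and D^j X vanishes in
   degree [k] for j > k. *)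
rewrite (fps_iterE n f0) (@iter_fps_comp_delta _ _ _ (n + k).+1) ?ltnS ?leq_addr //.
pose F j := 'C(n, j)%:R * iter j (fps_delta f) fpsX k.
rewrite (@big_ord_widen0 _ k.+1 _ F) ?ltnS ?leq_addl // => [|i lt_ki].
  by apply: eq_bigr => i _; rewrite binomial_fun_nat.
by rewrite /F iter_fps_delta_low ?mulr0 // ltnW.
Qed.

(** Coefficients on both sides are polynomial in [s], and for natural [s] both sides are the same
    iterate of [f]. *)
Lemma fps_iter_power f s n : tangent_to_id f ->
  fps_iter (fps_power f s) n = fps_power f (n%:R * s).
Proof.
move=> f_tan; apply/funext => k.
apply: (polynomial_fun_eq (u := fun s => fps_iter (fps_power f s) n k)
  (v := fun s => fps_power f (n%:R * s) k)).
- exact: polynomial_family_iter (polynomial_family_power f) k.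
- exact: polynomial_fun_comp (polynomial_family_power f k) (polynomial_fun_scale _).
- by move=> i; rewrite -natrM !fps_power_nat // fps_iterM //; case: f_tan.
Qed.

Lemma fps_power_iter f s n : tangent_to_id f ->
  fps_power (fps_iter f n) s = fps_power f (n%:R * s).
Proof.
move=> f_tan; have iter_tan : tangent_to_id (fps_iter f n).
  by rewrite -fps_power_nat //; exact: fps_power_tangent.
apply/funext => k.
apply: (polynomial_fun_eq (u := (fps_power (fps_iter f n))^~ k)
  (v := fun s => fps_power f (n%:R * s) k)).
- exact: polynomial_family_power (fps_iter f n) k.
- exact: polynomial_fun_comp (polynomial_family_power f k) (polynomial_fun_scale _).
- move=> i; rewrite -natrM !fps_power_nat // fps_iterM 1?mulnC //; by case: f_tan.
Qed.

Lemma fps_power1 f : tangent_to_id f -> fps_power f 1 = f.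
Proof. by move=> f_tan; rewrite -[1]/(1%:R) fps_power_nat // /fps_iter /= fps_comp_X. Qed.

Lemma fps_iter_root f n : tangent_to_id f -> (0 < n)%N ->
  fps_iter (fps_power f n%:R^-1) n = f.
Proof.
move=> f_tan n_gt0; rewrite fps_iter_power // mulfV ?fps_power1 //.
by rewrite (pcharf0P K).1 // -lt0n.
Qed.

(** Since (g^n)^s = g^(n s), the choice s = 1/n recovers g from f by a formula in f alone. *)
Lemma fps_iter_root_unique f g n : tangent_to_id g -> (0 < n)%N ->
  fps_iter g n = f -> fps_power f n%:R^-1 = g.
Proof.
move=> g_tan n_gt0 <-; rewrite fps_power_iter // mulfV ?fps_power1 //.
by rewrite (pcharf0P K).1 // -lt0n.
Qed.

End PolynomialFamilies.

(** * Absolute values of integers, factorials and binomial coefficients *)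

Section NonarchimedeanEstimates.
Context {R : realType} {K : fieldType} (abs : K -> R).
Context (abs_nonarch : nonarch_absolute_value abs).
Implicit Types (a b f h : fps K) (r c : R).

Let abs_ge0 := nonarch_abs_ge0 abs_nonarch.
Let absM := nonarch_absM abs_nonarch.

Lemma nonarch_abs_gt0 x : x != 0 -> 0 < abs x.
Proof.
move=> x_neq0; rewrite lt_def abs_ge0 andbT.
by apply: contra_neq x_neq0 => /(nonarch_abs_eq0 abs_nonarch).
Qed.

Lemma nonarch_abs0 : abs 0 = 0.
Proof. exact/(nonarch_abs_eq0 abs_nonarch). Qed.

Lemma nonarch_abs1 : abs 1 = 1.
Proof.
have abs1_neq0 : abs 1 != 0 by rewrite gt_eqF // nonarch_abs_gt0 ?oner_neq0.
by apply: (mulfI abs1_neq0); rewrite -absM !mulr1.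
Qed.

Lemma nonarch_absN x : abs (- x) = abs x.
Proof.
suff absN1 : abs (-1) = 1 by rewrite -mulN1r absM absN1 mul1r.
apply/eqP; rewrite -(@eqrXn2 _ 2) ?abs_ge0 ?ler01 //.
by rewrite !expr2 -absM mulrNN mulr1 nonarch_abs1 mulr1.
Qed.

Lemma nonarch_absV x : abs x^-1 = (abs x)^-1.
Proof.
have [->|x_neq0] := eqVneq x 0; first by rewrite invr0 nonarch_abs0 invr0.
have absx_neq0 : abs x != 0 by rewrite gt_eqF ?nonarch_abs_gt0.
by apply: (mulfI absx_neq0); rewrite -absM !mulfV ?nonarch_abs1.
Qed.

Lemma nonarch_abs_le_add x y (C : R) : abs x <= C -> abs y <= C -> abs (x + y) <= C.
Proof.
by move=> xC yC; apply: le_trans (nonarch_absD abs_nonarch x y) _; rewrite ge_max xC.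
Qed.

Lemma nonarch_abs_natr k : abs k%:R <= 1.
Proof.
elim: k => [|k IHk]; first by rewrite nonarch_abs0.
by rewrite -natr1 nonarch_abs_le_add ?nonarch_abs1.
Qed.

Lemma nonarch_abs_leD x y (w C : R) : 0 <= w ->
  abs x * w <= C -> abs y * w <= C -> abs (x + y) * w <= C.
Proof.
move=> w_ge0 xC yC.
apply: le_trans (ler_wpM2r w_ge0 (nonarch_absD abs_nonarch x y)) _.
by rewrite /Num.max; case: ifP.
Qed.

Lemma nonarch_abs_sum (I : Type) (s : seq I) (u : I -> K) (w C : R) :
  0 <= w -> 0 <= C -> (forall i, abs (u i) * w <= C) ->
  abs (\sum_(i <- s) u i) * w <= C.
Proof.
move=> w_ge0 C_ge0 uC; elim/big_ind: _ => [|x y|i _]; last exact: uC.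
  by rewrite nonarch_abs0 mul0r.
exact: nonarch_abs_leD.
Qed.

Section Factorial.
Context (K_char0 : [pchar K] =i pred0).

Lemma nonarch_abs_natr_gt0 k : (0 < k)%N -> 0 < abs k%:R.
Proof. by move=> k_gt0; rewrite nonarch_abs_gt0 // (pcharf0P K).1 // -lt0n. Qed.

(** If all positive integers have absolute value 1, then b = 1 works. Otherwise b = |p| for the
    least positive integer p with |p| < 1, by a recursion of Legendre type from j to the quotient of
    j by p. *)
Lemma nonarch_abs_fact_ge : exists2 b : R, 0 < b & forall j, b ^+ j <= abs j`!%:R.
Proof.
have [[p p_gt0 absp_lt1]|absE] := pselect (exists2 p, (0 < p)%N & abs p%:R < 1); last first.
  exists 1 => // j; rewrite expr1n leNgt; apply/negP => lt1.
  by apply: absE; exists j`! => //; exact: fact_gt0.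
have ex_p : exists p, (0 < p)%N && (abs p%:R < 1) by exists p; rewrite p_gt0.
case: (ex_minnP ex_p) => {p_gt0 absp_lt1 ex_p}{}p /andP[p_gt0 absp_lt1] p_min.
have p_gt1 : (1 < p)%N.
  by rewrite ltn_neqAle p_gt0 andbT; apply: contraTneq absp_lt1 => <-; rewrite nonarch_abs1 ltxx.
(* Minimality of p makes every remainder modulo p, hence every non-multiple
   of p, a unit. *)
have abs_unit k : ~~ (p %| k)%N -> abs k%:R = 1.
  move=> p_ndvd; apply/eqP; rewrite eq_le nonarch_abs_natr /= leNgt; apply/negP => absk_lt1.
  have /p_min : (0 < k %% p)%N && (abs (k %% p)%:R < 1).
    rewrite lt0n p_ndvd /=.
    have -> : (k %% p)%:R = k%:R + - ((k %/ p)%:R * p%:R) :> K.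
      by rewrite {2}(divn_eq k p) natrD natrM addrAC subrr add0r.
    apply: le_lt_trans (nonarch_absD abs_nonarch _ _) _.
    rewrite gt_max absk_lt1 nonarch_absN absM /=.
    by apply: le_lt_trans absp_lt1; rewrite ler_piMl ?nonarch_abs_natr.
  by rewrite leqNgt ltn_pmod.
have fact_div j : abs j`!%:R = abs p%:R ^+ (j %/ p) * abs (j %/ p)`!%:R.
  elim: j => [|j IHj]; first by rewrite div0n expr0 mul1r.
  rewrite factS natrM absM divnS //.
  (* If p divides j + 1 = p q, the quotient grows by one to q and the new factor is |p| |q|;
     otherwise the quotient is unchanged and the new factor is 1. *)
  have [/dvdnP[q j_qp]|p_ndvd] := boolP (p %| j.+1)%N; last by rewrite abs_unit // mul1r.
  have jq : (1 + j %/ p = q)%N.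
    by move: (divnS j p_gt0); rewrite j_qp dvdn_mull // mulnK.
  rewrite IHj j_qp -jq add1n factS !natrM !absM exprS.
  ring.
exists (abs p%:R); first exact: nonarch_abs_natr_gt0.
elim/ltn_ind => -[|j] IHj; first by rewrite expr0 nonarch_abs1.
rewrite fact_div.
have lt_div : (j.+1 %/ p < j.+1)%N by rewrite ltn_Pdiv.
apply: le_trans (ler_wpM2l _ (IHj _ lt_div)); last by rewrite exprn_ge0.
(* As p >= 2, twice the quotient by p is at most [j.+1], and powers of |p| <= 1 decrease. *)
rewrite -exprD; apply: ler_wiXn2l; rewrite ?nonarch_abs_natr //.
rewrite addnn -muln2; apply: leq_trans (leq_trunc_div j.+1 p).
by rewrite leq_mul2l p_gt1 orbT.
Qed.

(** Each factor 1/n - i = (1 - i n)/n has absolute value at most 1/|n|, and 1/|j!| is at most 1/b^j,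
    whence B = 1/(|n| b). *)
Lemma nonarch_abs_binomial_le n : (0 < n)%N ->
  exists2 B : R, 0 <= B & forall j, abs (binomial_fun n%:R^-1 j) <= B ^+ j.
Proof.
move=> n_gt0; have [b b_gt0 fact_ge] := nonarch_abs_fact_ge.
have absn_gt0 := nonarch_abs_natr_gt0 n_gt0.
have n_neq0 : n%:R != 0 :> K by rewrite (pcharf0P K).1 // -lt0n.
exists ((abs n%:R)^-1 / b) => [|j]; first by rewrite divr_ge0 ?invr_ge0 // ltW.
rewrite /binomial_fun absM nonarch_absV exprMn exprVn [_ ^-1 ^+ _]exprVn.
apply: ler_pM; rewrite ?invr_ge0 ?abs_ge0 //; last first.
  by rewrite lef_pV2 ?posrE ?exprn_gt0 ?nonarch_abs_natr_gt0 ?fact_gt0.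
rewrite (big_morph abs absM nonarch_abs1) -exprVn.
rewrite -[in leRHS](card_ord j) -prodr_const; apply: ler_prod => i _.
rewrite abs_ge0 /=.
have -> : n%:R^-1 - i%:R = (1 - (i * n)%:R) / n%:R :> K.
  by rewrite mulrBl natrM mulfK // mul1r.
rewrite absM nonarch_absV ler_piMl ?invr_ge0 ?abs_ge0 //.
by rewrite nonarch_abs_le_add ?nonarch_abs1 // nonarch_absN nonarch_abs_natr.
Qed.

End Factorial.

(** * Gauss norm bounds, |a|_r being the supremum of |a_k| r^k *)

Definition gauss_norm_le r (C : R) a := forall k, abs (a k) * r ^+ k <= C.

Lemma gauss_norm_le_mul r (A B : R) a b : 0 <= r -> 0 <= A -> 0 <= B ->
  gauss_norm_le r A a -> gauss_norm_le r B b -> gauss_norm_le r (A * B) (fps_mul a b).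
Proof.
move=> r_ge0 A_ge0 B_ge0 aA bB k.
apply: nonarch_abs_sum; rewrite ?exprn_ge0 ?mulr_ge0 // => i.
have le_ik : (i <= k)%N by rewrite -ltnS.
have -> : r ^+ k = r ^+ i * r ^+ (k - i) by rewrite -exprD subnKC.
rewrite absM mulrACA.
by apply: ler_pM; rewrite ?mulr_ge0 ?exprn_ge0.
Qed.

Lemma gauss_norm_leD r (C : R) a b : 0 <= r ->
  gauss_norm_le r C a -> gauss_norm_le r C b -> gauss_norm_le r C (fun k => a k + b k).
Proof. by move=> r_ge0 aC bC k; apply: nonarch_abs_leD; rewrite ?exprn_ge0. Qed.

Lemma gauss_norm_leX r i : 0 <= r -> gauss_norm_le r (r ^+ i) (fps_exp (@fpsX K) i).
Proof.
move=> r_ge0 k; rewrite fps_expX; case: eqP => [->|_].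
  by rewrite nonarch_abs1 mul1r.
by rewrite nonarch_abs0 mul0r exprn_ge0.
Qed.

Section Displacement.
Context (f : fps K) (r c : R) (r_ge0 : 0 <= r) (c_ge0 : 0 <= c) (c_le1 : c <= 1).
Context (f_disp : gauss_norm_le r (c * r) (fun k => f k - (k == 1%N)%:R)).

Lemma gauss_norm_le_tangent : gauss_norm_le r r f.
Proof.
have -> : f = fun k => f k - (k == 1%N)%:R + fps_exp (@fpsX K) 1 k.
  by apply/funext => k; rewrite fps_expX subrK.
apply: gauss_norm_leD => // k; last exact: gauss_norm_leX.
by apply: le_trans (f_disp k) _; rewrite ler_piMl.
Qed.

(** Induction through f^(i+1) - X^(i+1) = f (f^i - X^i) + (f - X) X^i, with |f|_r <= r. *)
Lemma gauss_norm_le_exp_sub i :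
  gauss_norm_le r (c * r ^+ i) (fun k => fps_exp f i k - (k == i)%:R).
Proof.
elim: i => [|i IHi] k; first by rewrite subrr nonarch_abs0 mul0r mulr_ge0 ?exprn_ge0.
have -> : fps_exp f i.+1 k - (k == i.+1)%:R =
    fps_mul f (fun k => fps_exp f i k - (k == i)%:R) k +
    fps_mul (fun k => f k - (k == 1%N)%:R) (fps_exp (@fpsX K) i) k.
  rewrite -fps_expX /= /fps_mul -sumrB -big_split; apply: eq_bigr => j _ /=.
  rewrite fps_expX /fpsX; ring.
have rk_ge0 : 0 <= r ^+ k by rewrite exprn_ge0.
apply: nonarch_abs_leD => //.
  have -> : c * r ^+ i.+1 = r * (c * r ^+ i) by rewrite exprS mulrCA.
  apply: gauss_norm_le_mul => //; last exact: gauss_norm_le_tangent.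
  by rewrite mulr_ge0 ?exprn_ge0.
have -> : c * r ^+ i.+1 = c * r * r ^+ i by rewrite exprS mulrA.
apply: gauss_norm_le_mul; rewrite ?mulr_ge0 ?exprn_ge0 //; exact: gauss_norm_leX.
Qed.

(** By the ultrametric inequality it suffices that |h_i| |f^i - X^i|_r <= |h_i| c r^i <= C c. *)
Lemma gauss_norm_le_delta h (C : R) : 0 <= C ->
  gauss_norm_le r C h -> gauss_norm_le r (C * c) (fps_delta f h).
Proof.
move=> C_ge0 hC k; rewrite fps_deltaE.
apply: nonarch_abs_sum; rewrite ?mulr_ge0 ?exprn_ge0 // => i.
rewrite absM -mulrA; apply: le_trans (ler_wpM2l (abs_ge0 _) (gauss_norm_le_exp_sub i k)) _.
by rewrite [c * _]mulrC mulrA ler_wpM2r.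
Qed.

Lemma gauss_norm_le_iter_delta j :
  gauss_norm_le r (r * c ^+ j) (iter j (fps_delta f) (@fpsX K)).
Proof.
elim: j => [|j IHj].
  by move=> k; have := gauss_norm_leX 1 r_ge0 k; rewrite fps_expX mulr1.
by rewrite exprSr mulrA; apply: gauss_norm_le_delta; rewrite ?mulr_ge0 ?exprn_ge0.
Qed.

(** The j-th Newton term has norm at most B^j c^j r <= r. *)
Lemma gauss_norm_le_power s (B : R) : 0 <= B -> B * c <= 1 ->
  (forall j, abs (binomial_fun s j) <= B ^+ j) -> gauss_norm_le r r (fps_power f s).
Proof.
move=> B_ge0 Bc_le1 sB k; apply: nonarch_abs_sum; rewrite ?exprn_ge0 // => j.
rewrite absM -mulrA.
apply: le_trans (ler_pM _ _ (sB j) (gauss_norm_le_iter_delta j k)) _;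
  rewrite ?mulr_ge0 ?exprn_ge0 //.
by rewrite mulrCA -exprMn ler_piMr // exprn_ile1 // mulr_ge0.
Qed.

End Displacement.

(** * Gauss norm bounds and the radius of convergence *)

Lemma convergent_gauss_norm_le a : convergent_fps abs a ->
  exists r M, [/\ 0 < r, 0 < M & gauss_norm_le r M a].
Proof.
move=> /ereal_sup_gt[_ [r [_ a_cvg] <-]]; rewrite lte_fin => r_gt0.
have /cvg_seq_bounded[M0 [_ aM]] : cvgn (fun k => abs (a k) * r ^+ k : R^o).
  by apply/cvg_ex; exists 0.
(* Any real above [M0] bounds the sequence; this one is also positive. *)
exists r, (`|M0| + 1); split=> // k.
have /aM/(_ k I) : M0 < `|M0| + 1 by rewrite ltr_pwDr ?ler_norm.
by apply: le_trans; rewrite ler_norm.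
Qed.

(** Halving the radius turns the bound C into the geometric bound C 2^(-k), which tends to 0. *)
Lemma gauss_norm_le_convergent r (C : R) a : 0 < r -> gauss_norm_le r C a ->
  convergent_fps abs a.
Proof.
move=> r_gt0 aC; have r2_gt0 : 0 < r / 2 by rewrite divr_gt0.
apply: (@lt_le_trans _ _ (r / 2)%:E); first by rewrite lte_fin.
apply: ereal_sup_ubound; exists (r / 2) => //; split; first exact: ltW.
apply: (@squeeze_cvgr _ _ _ _ (fun=> 0) (geometric C 2^-1)).
- apply: nearW => k; rewrite mulr_ge0 ?exprn_ge0 ?(ltW r2_gt0) //=.
  by rewrite exprMn mulrA ler_wpM2r // exprn_ge0.
- exact: cvg_cst.
- by apply: cvg_geometric; rewrite ger0_norm // invf_lt1 ?ltr1n.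
Qed.

Lemma convergent_power f s (B : R) : tangent_to_id f -> convergent_fps abs f ->
  0 <= B -> (forall j, abs (binomial_fun s j) <= B ^+ j) ->
  convergent_fps abs (fps_power f s).
Proof.
move=> [f0 f1] /convergent_gauss_norm_le[rho [M [rho_gt0 M_gt0 fM]]] B_ge0 sB.
have MB_gt0 : 0 < M * (B + 1) by rewrite mulr_gt0 // ltr_wpDl.
have den_gt0 : 0 < rho + M * (B + 1) by rewrite addr_gt0.
(* At radius rho t the series f - X = O(x^2) has norm at most M t^2 = c (rho t). The choice of t
   gives (B + 1) c <= 1, hence both B c <= 1 and c <= 1. *)
pose t := rho / (rho + M * (B + 1)); pose c := M * t / rho.
have t_gt0 : 0 < t by rewrite divr_gt0.
have t_le1 : t <= 1 by rewrite ler_pdivrMr // mul1r lerDl ltW.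
have c_gt0 : 0 < c by rewrite divr_gt0 // mulr_gt0.
have Bc_le1 : (B + 1) * c <= 1.
  have -> : (B + 1) * c = M * (B + 1) / (rho + M * (B + 1)).
    by rewrite /c /t; field; rewrite !gt_eqF.
  by rewrite ler_pdivrMr // mul1r lerDr ltW.
have rhot_gt0 : 0 < rho * t by rewrite mulr_gt0.
apply: (@gauss_norm_le_convergent (rho * t) (rho * t)) => //.
have c_le1 : c <= 1.
  by apply: le_trans Bc_le1; rewrite mulrDl mul1r lerDr mulr_ge0 // ltW.
apply: (gauss_norm_le_power (ltW rhot_gt0) (ltW c_gt0) c_le1 _ B_ge0 _ sB).
- move=> [|[|k]]; rewrite ?f0 ?f1 ?subrr ?nonarch_abs0 ?mul0r;
    try by rewrite mulr_ge0 ?ltW.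
  (* Only degrees at least 2 remain, where t^(k+2) <= t^2. *)
  have -> : c * (rho * t) = M * t ^+ 2 by rewrite /c; field; rewrite gt_eqF.
  rewrite subr0 exprMn mulrA; apply: ler_pM => //.
  + by rewrite mulr_ge0 ?exprn_ge0 ?(ltW rho_gt0).
  + by rewrite exprn_ge0 ?(ltW t_gt0).
  + by apply: ler_wiXn2l; rewrite ?(ltW t_gt0).
- by apply: le_trans Bc_le1; rewrite ler_pM2r // lerDl.
Qed.

End NonarchimedeanEstimates.

Theorem corollary5p8 (R : realType) (K : fieldType) (abs : K -> R)
    (K_char0 : [pchar K] =i pred0)
    (abs_nonarch : nonarch_absolute_value abs)
    (abs_nontrivial : nontrivial_abs abs)
    (K_complete : abs_complete abs)
    (m : nat) (m_ge2 : (2 <= m)%N)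
    (f : fps K) (f_conv : convergent_fps abs f) (mu : K)
    (f_form : forall k : nat, (k < 2 * m)%N ->
       f k = (k == 1%N)%:R + (k == m)%:R + mu * (k == 2 * m - 1)%N%:R)
    (n : nat) (n_ge1 : (1 <= n)%N) :
  exists! g : fps K,
    [/\ convergent_fps abs g, tangent_to_id g & fps_iter g n = f].
Proof.
(* As m >= 2, degrees 0 and 1 lie below 2m and differ from m and 2m - 1. *)
have f_tan : tangent_to_id f.
  split; rewrite f_form; try lia.
    have [-> ->] : (0 == m)%N = false /\ (0 == 2 * m - 1)%N = false by split; lia.
    by rewrite mulr0 !addr0.
  have [-> ->] : (1 == m)%N = false /\ (1 == 2 * m - 1)%N = false by split; lia.
  by rewrite mulr0 !addr0.
have [B B_ge0 binB] := nonarch_abs_binomial_le abs_nonarch K_char0 n_ge1.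
exists (fps_power f n%:R^-1); split=> [|g [_ g_tan g_iter]].
  split; [exact: convergent_power f_conv B_ge0 binB|exact: fps_power_tangent|].
  exact: fps_iter_root.
exact: fps_iter_root_unique.
Qed.
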